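(* Let $p$ be a prime, $G$ a finite $p$-group of nilpotency class $2$, and $w\in F_k$. (i) If $w\notin[F_k,F_k]$, then either $P_{w,G}$ is a constant function on $G$, or there exist integers $r>0$, $1\le\ell\le n\le k$ and nonnegative integers $s_1,\dots,s_{n-1}$ with $s_1<s_2<\cdots<s_{\ell-1}<r$ and $s_j<r$ for all $j\ge\ell$, such that $w$ and $v_p(p^r,\ell;s_1,\dots,s_{n-1})$ are $F_k(G)$-automorphic. (ii) If $w\in[F_k,F_k]$, then there exist $n\le k$ and nonnegative integers $s_1,\dots,s_{n-1}$ such that $w$ and $v_p(0,1;s_1,\dots,s_{n-1})$ are $F_k(G)$-automorphic.
   Context: $F_k$ is the free group on $x_1,\dots,x_k$; $[F_k,F_k]$ its commutator subgroup; $[a,b]:=aba^{-1}b^{-1}$. For $w\in F_k$, $P_{w,G}(g):=|\{(g_1,\dots,g_k)\in G^k: w(g_1,\dots,g_k)=g\}|/|G|^k$. The set $F_k(G)$ of word maps $G^k\to G$ induced by elements of $F_k$ is a group under pointwise multiplication; $w_1,w_2\in F_k$ are $F_k(G)$-automorphic if some group automorphism of $F_k(G)$ sends the word map of $w_1$ to that of $w_2$. For $t_0\ge0$, $1\le\ell\le n\le k$ and nonnegative integers $s_i$, $$v_p(t_0,\ell;s_1,\dots,s_{n-1}):=x_1^{t_0}\Big(\prod_{i=1}^{\ell-1}[x_i,x_{i+1}]^{p^{s_i}}\Big)\Big([x_\ell,x_{\ell+1}]^{p^{s_\ell}}[x_{\ell+2},x_{\ell+3}]^{p^{s_{\ell+2}}}\cdots[x_{n-1},x_n]^{p^{s_{n-1}}}\Big),$$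 where the last factor is the product of $[x_j,x_{j+1}]^{p^{s_j}}$ over $j=\ell,\ell+2,\ell+4,\dots$ with $j\le n-1$ (empty if $\ell\ge n$). *)

(* Defs.v *)
From HB Require Import structures.
From mathcomp Require Import all_boot all_order all_algebra all_fingroup all_solvable.
Set Implicit Arguments. Unset Strict Implicit. Unset Printing Implicit Defensive.

(* Elements of the free group F_k are represented by words: sequences of
   letters (i, b) standing for x_(i+1) if b = false and x_(i+1)^-1 if b = true
   (indices i : 'I_k are 0-based). Two words denote the same element of F_k
   iff they have the same free reduction. *)
Definition letter k := ('I_k * bool)%type.
Definition word k := seq (letter k).

Definition red_step k (l : letter k) (s : word k) : word k :=
  match s with
  | l' :: s' => if (l'.1 == l.1) && (l'.2 == ~~ l.2) then s' else l :: s
  | [::] => [:: l]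
  end.
Definition freduce k (w : word k) : word k := foldr (@red_step k) [::] w.

Definition winv k (w : word k) : word k := rev [seq (l.1, ~~ l.2) | l <- w].
Definition wcomm k (a b : word k) : word k := a ++ b ++ winv a ++ winv b.

(* w lies in the commutator subgroup [F_k,F_k]: w equals in F_k a finite
   product of commutators (these products form [F_k,F_k]) *)
Definition in_commutator_sub k (w : word k) : Prop :=
  exists cs : seq (word k * word k),
    freduce w = freduce (flatten [seq wcomm c.1 c.2 | c <- cs]).

Section WordMaps.
Variable gT : finGroupType.
Variable k : nat.
Local Open Scope group_scope.

Definition tup := {ffun 'I_k -> gT}.
Definition wmapT := {ffun tup -> gT}.

Definition eval_word (w : word k) (x : tup) : gT :=
  foldr (fun l acc => (if l.2 then (x l.1)^-1 else x l.1) * acc) 1 w.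

Definition wmap (w : word k) : wmapT := [ffun x => eval_word w x].

Definition wmul (f g : wmapT) : wmapT := [ffun x => f x * g x].

Definition is_wordmap (f : wmapT) : Prop := exists w : word k, f = wmap w.

Definition Fk_automorphic (w1 w2 : word k) : Prop :=
  exists phi : wmapT -> wmapT,
    [/\ (forall f, is_wordmap f -> is_wordmap (phi f)),
        (forall f g, is_wordmap f -> is_wordmap g -> phi f = phi g -> f = g),
        (forall g, is_wordmap g -> exists2 f, is_wordmap f & phi f = g),
        (forall f g, is_wordmap f -> is_wordmap g ->
            phi (wmul f g) = wmul (phi f) (phi g))
      & phi (wmap w1) = wmap w2].

Definition Pw (w : word k) (g : gT) : rat :=
  (#|[set x : tup | eval_word w x == g]|%:R / (#|gT| ^ k)%:R)%R.

Definition Pw_constant (w : word k) : Prop := forall g h : gT, Pw w g = Pw w h.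
End WordMaps.

(* the generator x_i (1-based i; requires 1 <= i <= k) *)
Definition xgen k (i : nat) : letter k.+1 := (inord i.-1, false).

Definition commpow k (p i e : nat) : word k.+1 :=
  flatten (nseq (p ^ e) (wcomm [:: xgen k i] [:: xgen k i.+1])).

Definition vp k (p t0 l n : nat) (s : nat -> nat) : word k.+1 :=
  nseq t0 (xgen k 1)
  ++ flatten [seq commpow k p i (s i) | i <- iota 1 l.-1]
  ++ flatten [seq commpow k p j (s j) | j <- iota l (n - l) & ~~ odd (j - l)].

(* Main.v *)
(* In a group of nilpotency class 2 commutators are central and bimultiplicative.
   Hence every word map equals [\prod_i x_i^a_i] times a commutator form
   [\prod_(i, j) [x_i, x_j]^D_ij], where the exponents live in Z/|G| and only the
   alternating part of D matters. Substitutions whose exponent matrix is invertible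
   modulo p permute G^k and therefore induce automorphisms of F_k(G). A first one
   turns the power part into [x_i^(p^r)]. If [r = 0], the commutator form can be
   absorbed into [x_i], so the word map is a coordinate followed by a permutation of
   G^k and is equidistributed. Otherwise the form is diagonalised by pivoting on
   entries of increasing p-adic valuation t: a pivot avoiding the current end c of
   the chain starting at [x_i] splits off a block [[x_a, x_b]^(p^t)], while a pivot
   in row c is used only when no other one exists at level t, so it extends the chain
   with a strictly larger exponent. Whatever is divisible by [p^r] is absorbed into
   [x_i^(p^r)] by multiplying [x_i] by a product of commutators. *)
From HB Require Import structures.
Require Import Defs.
From mathcomp Require Import all_boot all_order all_algebra all_fingroup all_solvable.
Set Implicit Arguments. Unset Strict Implicit. Unset Printing Implicit Defensive.
Import GRing.Theory FiniteModule.

Local Open Scope group_scope.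

(** * Substitutions *)

Section Substitutions.
Variables (gT : finGroupType) (k : nat).
Implicit Types (w : word k) (u v : 'I_k -> word k) (x y : tup gT k).

Lemma eval_cat w1 w2 x : eval_word (w1 ++ w2) x = eval_word w1 x * eval_word w2 x.
Proof. by elim: w1 => [|l w1 IH] /=; rewrite ?mul1g // IH mulgA. Qed.

Lemma eval_flatten (T : Type) (F : T -> word k) s x :
  eval_word (flatten [seq F i | i <- s]) x = \prod_(i <- s) eval_word (F i) x.
Proof. by elim: s => [|i s IH] /=; rewrite ?big_nil // big_cons eval_cat IH. Qed.

Lemma eval_flatten_nseq n w x : eval_word (flatten (nseq n w)) x = eval_word w x ^+ n.
Proof. by elim: n => [|n IH] //=; rewrite eval_cat IH expgS. Qed.

Lemma eval_nseq n (i : 'I_k) x : eval_word (nseq n (i, false)) x = x i ^+ n.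
Proof. by elim: n => [|n IH] //=; rewrite IH expgS. Qed.

Lemma eval_winv w x : eval_word (winv w) x = (eval_word w x)^-1.
Proof.
elim: w => [|l w IH] /=; first by rewrite invg1.
rewrite /winv /= rev_cons -cats1 eval_cat -/(winv w) IH invMg /= mulg1.
by case: l.2; rewrite //= invgK.
Qed.

Lemma eval_freduce w x : eval_word (freduce w) x = eval_word w x.
Proof.
elim: w => //= l w <-; case: (freduce w) => [|l' s] //=.
case: ifP => //= /andP[/eqP-> /eqP->].
by case: l.2; rewrite /= ?mulKg ?mulKVg.
Qed.

(** The endomorphism [x_i -> u i] of the free group, seen as a self-map of the tuples. *)
Definition wsub u x : tup gT k := [ffun i => eval_word (u i) x].

Definition wcomp u w : word k :=
  flatten [seq if l.2 then winv (u l.1) else u l.1 | l <- w].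

Lemma eval_wcomp u w x : eval_word (wcomp u w) x = eval_word w (wsub u x).
Proof.
rewrite /wcomp; elim: w => //= l w IH; rewrite eval_cat IH ffunE.
by case: l.2; rewrite ?eval_winv.
Qed.

Lemma wsub_comp u v x : wsub u (wsub v x) = wsub (fun i => wcomp v (u i)) x.
Proof. by apply/ffunP => i; rewrite !ffunE eval_wcomp. Qed.

Definition wid (i : 'I_k) : word k := [:: (i, false)].

Lemma wsub_id x : wsub wid x = x.
Proof. by apply/ffunP => i; rewrite ffunE /= mulg1. Qed.

(* A bijective substitution has finite order, so its inverse is one of its
   powers and hence again a substitution. *)
Lemma wsub_inverse u : injective (wsub u) ->
  exists v, [/\ injective (wsub v), cancel (wsub u) (wsub v) & cancel (wsub v) (wsub u)].
Proof.
move=> inj_u; pose s := perm inj_u.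
have iterP n : exists v, forall x, wsub v x = (s ^+ n) x.
  elim: n => [|n [v IH]]; first by exists wid => x; rewrite expg0 perm1 wsub_id.
  exists (fun i => wcomp v (u i)) => x.
  by rewrite -wsub_comp IH expgSr permM permE.
have [v vE] := iterP #[s].-1.
have vV x : wsub v x = s^-1 x by rewrite vE invg_expg.
have uK : cancel (wsub u) (wsub v).
  by move=> x; rewrite vV -[wsub u x](permE inj_u) permK.
have vK : cancel (wsub v) (wsub u).
  by move=> x; rewrite vV -[wsub u _](permE inj_u) permKV.
by exists v; split=> //; apply: can_inj vK.
Qed.

(** Precomposition with a substitution respects pointwise products and preserves word maps; the
    inverse substitution makes it bijective on them. *)
Lemma substitution_automorphic w1 w2 u :
  injective (wsub u) -> (forall x, eval_word w1 (wsub u x) = eval_word w2 x) ->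
  Fk_automorphic gT w1 w2.
Proof.
move=> inj_u w12; have [v [_ uK vK]] := wsub_inverse inj_u.
exists (fun f => [ffun x => f (wsub u x)]); split.
- by move=> _ [w ->]; exists (wcomp u w); apply/ffunP => x; rewrite !ffunE eval_wcomp.
- move=> f g _ _ /ffunP fg; apply/ffunP => x.
  by have := fg (wsub v x); rewrite !ffunE vK.
- move=> _ [w ->]; exists (wmap gT (wcomp v w)); first by exists (wcomp v w).
  by apply/ffunP => x; rewrite !ffunE eval_wcomp uK.
- by move=> f g _ _; apply/ffunP => x; rewrite !ffunE.
- by apply/ffunP => x; rewrite !ffunE w12.
Qed.

(* Both fibres are in bijection with sets of tuples having a prescribed
   coordinate, which are translates of each other. *)
Lemma coordinate_Pw_constant w v i :
  injective (wsub v) -> (forall x, eval_word w x = wsub v x i) -> Pw_constant gT w.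
Proof.
move=> inj_v wE.
suff cardE g h : (#|[set x : tup gT k | eval_word w x == g]|
                  <= #|[set x : tup gT k | eval_word w x == h]|)%N.
  move=> g h; rewrite /Pw; congr (_%:R / _)%R.
  by apply/eqP; rewrite eqn_leq !cardE.
have [v' [_ vK v'K]] := wsub_inverse inj_v.
pose T (y : tup gT k) : tup gT k := [ffun j => if j == i then h * g^-1 * y j else y j].
have injT : injective T.
  move=> y z /ffunP yz; apply/ffunP => j; have := yz j; rewrite !ffunE.
  by case: eqP => // _ /mulgI.
have inj : injective (fun x => wsub v' (T (wsub v x))).
  exact: inj_comp (can_inj v'K) (inj_comp injT inj_v).
rewrite -(card_imset _ inj); apply/subset_leq_card/subsetP => _ /imsetP[x + ->].
by rewrite !inE !wE v'K [T _ _]ffunE eqxx => /eqP->; rewrite mulgKV.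
Qed.

End Substitutions.

(** * The centre as a module and the commutator pairing *)

Notation expring gT := ('Z_#|[set: (gT : finGroupType)]|).

Section Exponents.
Variable gT : finGroupType.
Implicit Types (g : gT) (a b : expring gT).

(* For the trivial group ['Z_1] is ℤ/2, but powers still only depend on the
   exponent modulo 2. *)
Lemma expg_Zp_trunc g : g ^+ (Zp_trunc #|[set: gT]|).+2 = 1.
Proof.
have [q_gt1|q_le1] := ltnP 1 #|[set: gT]|.
  by rewrite Zp_cast // expg_cardG ?inE.
suff -> : g = 1 by rewrite expg1n.
have /card_le1_trivg T1 := q_le1.
by have := in_setT g; rewrite T1 => /set1P.
Qed.

Lemma expg_modZ g n : g ^+ (n %% (Zp_trunc #|[set: gT]|).+2) = g ^+ n.
Proof. exact: expg_mod (expg_Zp_trunc g). Qed.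

Lemma expg_ZpD g a b : g ^+ (a + b)%R = g ^+ a * g ^+ b.
Proof. by rewrite expg_modZ expgD. Qed.

Lemma expg_ZpM g a b : g ^+ (a * b)%R = g ^+ a ^+ b.
Proof. by rewrite expg_modZ expgM. Qed.

Lemma expg_ZpN g a : g ^+ (- a)%R = (g ^+ a)^-1.
Proof. by apply: (mulIg (g ^+ a)); rewrite mulVg -expg_ZpD addNr. Qed.

Lemma expg_Zp_inj a : a \is a GRing.unit -> injective (fun g : gT => g ^+ a).
Proof.
move=> ua g h /= gh; have := congr1 (fun z => z ^+ (a^-1)%R) gh.
by rewrite -!expg_ZpM divrr // !expg1.
Qed.

(** The centre written additively, under its own name so that it can carry a module structure over
    the exponent ring; commutators then obey matrix algebra. *)
Definition center_mod := fmod_of (center_abelian [set: gT]).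
HB.instance Definition _ := GRing.Zmodule.on center_mod.

Definition center_scale a (z : center_mod) : center_mod := (z *+ a)%R.

Lemma center_mulrn_modZ (z : center_mod) n :
  (z *+ (n %% (Zp_trunc #|[set: gT]|).+2) = z *+ n)%R.
Proof. by apply: fmod_inj; rewrite !fmvalZ expg_modZ. Qed.

Fact center_scaleA a b z :
  center_scale a (center_scale b z) = center_scale (a * b)%R z.
Proof. by rewrite /center_scale center_mulrn_modZ mulnC mulrnA. Qed.

Fact center_scale1 : left_id 1%R center_scale.
Proof. by move=> z; rewrite /center_scale mulr1n. Qed.

Fact center_scaleDr : right_distributive center_scale +%R.
Proof. by move=> a y z; rewrite /center_scale mulrnDl. Qed.

Fact center_scaleDl z : {morph center_scale^~ z : a b / (a + b)%R}.
Proof. by move=> a b; rewrite /center_scale center_mulrn_modZ mulrnDr. Qed.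

HB.instance Definition _ := GRing.Zmodule_isLmodule.Build (expring gT) center_mod
  center_scaleA center_scale1 center_scaleDr center_scaleDl.

Definition cval (z : center_mod) : gT := fmval z.

Lemma cvalD y z : cval (y + z)%R = cval y * cval z. Proof. by []. Qed.
Lemma cval0 : cval 0%R = 1. Proof. by []. Qed.
Lemma cvalMn z n : cval (z *+ n)%R = cval z ^+ n. Proof. exact: fmvalZ. Qed.
Lemma cval_sum (I : Type) (s : seq I) (P : pred I) F :
  cval (\sum_(i <- s | P i) F i)%R = \prod_(i <- s | P i) cval (F i).
Proof. exact: (big_morph cval cvalD cval0). Qed.
Lemma cvalC z g : commute (cval z) g.
Proof. by apply/commute_sym/(centerC (in_setT g))/fmodP. Qed.

(** [fmod] is total, so this is faithful only once the commutator is known to be central, which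
    [class2] ensures. *)
Definition cpair (g h : gT) : center_mod := fmod (center_abelian [set: gT]) [~ g, h].

Hypothesis class2 : nil_class [set: gT] <= 2.

Lemma commg_center (g h : gT) : [~ g, h] \in 'Z([set: gT]).
Proof.
by apply: (subsetP _ _ (mem_commg (in_setT g) (in_setT h))); rewrite -nil_class2.
Qed.

Lemma cval_cpair g h : cval (cpair g h) = [~ g, h].
Proof. exact/fmodK/commg_center. Qed.

Lemma commg_commute (g h z : gT) : commute [~ g, h] z.
Proof. by rewrite -cval_cpair; apply: cvalC. Qed.

Lemma cpairMl g1 g2 h : cpair (g1 * g2) h = (cpair g1 h + cpair g2 h)%R.
Proof.
apply: fmod_inj; rewrite -[LHS]/(cval _) -[RHS]/(cval _) cvalD !cval_cpair commMgJ.
by rewrite conjgE commg_commute mulKg.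
Qed.

Lemma cpairC g h : cpair h g = (- cpair g h)%R.
Proof. by rewrite /cpair -fmodV invgR. Qed.

Lemma cpairMr g h1 h2 : cpair g (h1 * h2) = (cpair g h1 + cpair g h2)%R.
Proof. by rewrite !(cpairC _ g) cpairMl opprD. Qed.

Lemma cpair1l h : cpair 1 h = 0%R.
Proof. by rewrite /cpair comm1g fmod1. Qed.

Lemma cpair_diag g : cpair g g = 0%R.
Proof. by rewrite /cpair commgg fmod1. Qed.

Lemma cpairVl g h : cpair g^-1 h = (- cpair g h)%R.
Proof. by apply/eqP; rewrite -addr_eq0 -cpairMl mulVg cpair1l. Qed.

Lemma commute_cpair g h : g * h = h * g * cval (cpair g h).
Proof. by rewrite cval_cpair commgC. Qed.

(** Reconciles two conventions: [wcomm] uses [g h g^-1 h^-1], while [[~ g, h]] is [g^-1 h^-1 g h].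
    They agree when commutators are central. *)
Lemma mul_comm_cpair g h : g * h * g^-1 * h^-1 = cval (cpair g h).
Proof. by rewrite (commute_cpair g h) -!mulgA cvalC !mulgA mulgK mulgV mul1g. Qed.

End Exponents.

(** * Commutator forms *)

Section CommutatorForms.
Variables (gT : finGroupType) (k : nat).
Hypothesis class2 : nil_class [set: gT] <= 2.
Local Notation R := (expring gT).
Implicit Types (w : word k) (u v : 'I_k -> word k) (x y : tup gT k) (D : 'M[R]_k).
Local Open Scope ring_scope.

Definition cform D x : center_mod gT :=
  \sum_i \sum_j D i j *: cpair (x i) (x j).

Lemma cformD D1 D2 x : cform (D1 + D2) x = cform D1 x + cform D2 x.
Proof.
rewrite /cform -big_split; apply: eq_bigr => i _ /=.
by rewrite -big_split; apply: eq_bigr => j _ /=; rewrite mxE scalerDl.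
Qed.

Lemma cformZ a D x : cform (a *: D) x = a *: cform D x.
Proof.
rewrite /cform scaler_sumr; apply: eq_bigr => i _ /=.
by rewrite scaler_sumr; apply: eq_bigr => j _ /=; rewrite mxE scalerA.
Qed.

Lemma cform0 x : cform 0 x = 0.
Proof. by rewrite -(scale0r (0 : 'M[R]_k)) cformZ scale0r. Qed.

Lemma cform_delta a b x : cform (delta_mx a b) x = cpair (x a) (x b).
Proof.
rewrite /cform (bigD1 a) //= [X in _ + X]big1 ?addr0 => [|i /negPf ia]; last first.
  by apply: big1 => j _; rewrite mxE ia scale0r.
rewrite (bigD1 b) //= big1 ?addr0 => [|j /negPf jb].
  by rewrite mxE !eqxx scale1r.
by rewrite mxE jb andbF scale0r.
Qed.

(** Terms [(i, j)] and [(j, i)] cancel, and diagonal terms vanish separately; there is no division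
    by 2, so [p = 2] is covered. *)
Lemma cform_symmetric D x : D^T = D -> cform D x = 0.
Proof.
move=> symD; pose F i j : center_mod gT := D i j *: cpair (x i) (x j).
have F0 i : F i i = 0 by rewrite /F cpair_diag // scaler0.
have FN i j : F j i = - F i j by rewrite /F cpairC scalerN -[in LHS]symD mxE.
have -> : cform D x = \sum_(i : 'I_k) \sum_(j : 'I_k | (i < j)%N) F i j
                    + \sum_(i : 'I_k) \sum_(j : 'I_k | (j < i)%N) F i j.
  rewrite -big_split; apply: eq_bigr => i _ /=.
  rewrite (eq_bigr (F i)) // (bigID (fun j : 'I_k => (i < j)%N)) /=; congr (_ + _).
  rewrite (bigD1 i) ?ltnn //= F0 add0r; apply: eq_bigl => j.
  by rewrite -leqNgt ltn_neqAle andbC.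
rewrite [X in _ + X](exchange_big_dep xpredT) //= -big_split big1 // => i _ /=.
by rewrite -big_split big1 // => j _ /=; rewrite (FN i j) subrr.
Qed.

Definition skewpart D : 'M[R]_k := D - D^T.

Lemma cform_skew D1 D2 x : skewpart D1 = skewpart D2 -> cform D1 x = cform D2 x.
Proof.
move=> sk; rewrite -[D1](subrK D2) cformD cform_symmetric ?add0r //.
apply/matrixP => i j; have := congr1 (fun M : 'M_k => M i j) sk; rewrite !mxE => h.
have -> : D1 i j = D1 j i + (D2 i j - D2 j i) by rewrite -h addrCA subrr addr0.
by rewrite [D2 i j - _]addrC addrA addrK.
Qed.

Lemma skewE D i j : skewpart D i j = D i j - D j i.
Proof. by rewrite !mxE. Qed.

Lemma skew_diag D i : skewpart D i i = 0.
Proof. by rewrite skewE subrr. Qed.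

Lemma skewN D i j : skewpart D j i = - skewpart D i j.
Proof. by rewrite !skewE opprB. Qed.

Definition letter_expo (l : letter k) : 'rV[R]_k :=
  if l.2 then - delta_mx 0 l.1 else delta_mx 0 l.1.

(** The image of [w] in the abelianisation of the free group, with exponents reduced to [R]. *)
Definition expo w : 'rV[R]_k := \sum_(l <- w) letter_expo l.

Lemma expo_cat w1 w2 : expo (w1 ++ w2) = expo w1 + expo w2.
Proof. exact: big_cat. Qed.

Lemma expo_flatten (T : Type) (F : T -> word k) s :
  expo (flatten [seq F i | i <- s]) = \sum_(i <- s) expo (F i).
Proof.
by elim: s => [|i s IH] /=; rewrite ?big_cons ?expo_cat ?IH // /expo !big_nil.
Qed.

Lemma expo_flatten_nseq n w : expo (flatten (nseq n w)) = n%:R *: expo w.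
Proof.
elim: n => [|n IH] /=; first by rewrite scale0r /expo big_nil.
by rewrite expo_cat IH -natr1 scalerDl scale1r addrC.
Qed.

Lemma expo_wid i : expo (wid i) = delta_mx 0 i.
Proof. by rewrite /expo big_seq1. Qed.

Lemma expo_nseq n (i : 'I_k) : expo (nseq n (i, false)) = n%:R *: delta_mx 0 i.
Proof.
by rewrite -(expo_wid i) -expo_flatten_nseq; congr expo; elim: n => //= n {1}->.
Qed.

Lemma expo_winv w : expo (winv w) = - expo w.
Proof.
elim: w => [|l w IH]; first by rewrite /expo !big_nil oppr0.
rewrite /winv /= rev_cons -cats1 expo_cat -/(winv w) IH -[l :: w]cat1s expo_cat opprD addrC.
by congr (_ + _); rewrite /expo !big_seq1 /letter_expo /=; case: l.2; rewrite ?opprK.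
Qed.

Lemma expo_wcomm w1 w2 : expo (wcomm w1 w2) = 0.
Proof.
rewrite /wcomm !expo_cat !expo_winv addrCA addrA [expo w2 + _]addrC.
by rewrite -addrA [expo w2 + _]addrA [expo w2 - _]addrC addrK subrr.
Qed.

Lemma cpair_eval w x g : cpair (eval_word w x) g = \sum_i expo w 0 i *: cpair (x i) g.
Proof.
elim: w => [|l w IH].
  by rewrite cpair1l // big1 // => i _; rewrite /expo big_nil mxE scale0r.
rewrite /= cpairMl // IH -cat1s expo_cat.
under [RHS]eq_bigr do rewrite mxE scalerDl.
rewrite big_split /=; congr (_ + _).
rewrite (bigD1 l.1) //= big1 ?addr0 => [|i /negPf il].
  rewrite /expo big_seq1 /letter_expo; case: l.2; rewrite !mxE !eqxx ?scale1r //.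
  by rewrite scaleN1r cpairVl.
by rewrite /expo big_seq1 /letter_expo; case: l.2; rewrite !mxE il ?oppr0 scale0r.
Qed.

Definition sub_mx u : 'M[R]_k := \matrix_i expo (u i).

Lemma cpair_wsub u x i g :
  cpair (wsub u x i) g = \sum_j sub_mx u i j *: cpair (x j) g.
Proof. by rewrite ffunE cpair_eval; apply: eq_bigr => j _; rewrite mxE. Qed.

(** The pairing sees only exponents ([cpair_eval]), so a substitution acts by a linear change of
    variables on a bilinear form. *)
Lemma cform_wsub u D x : cform D (wsub u x) = cform ((sub_mx u)^T *m D *m sub_mx u) x.
Proof.
set L := sub_mx u.
have pairE i j : cpair (wsub u x i) (wsub u x j) =
    \sum_m \sum_n (L i m * L j n) *: cpair (x m) (x n).
  rewrite cpair_wsub; apply: eq_bigr => m _.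
  rewrite cpairC cpair_wsub -sumrN scaler_sumr; apply: eq_bigr => n _.
  by rewrite -scalerN -cpairC scalerA.
pose F m n i j : center_mod gT := (D i j * (L i m * L j n)) *: cpair (x m) (x n).
transitivity (\sum_i \sum_j \sum_m \sum_n F m n i j).
  rewrite /cform; apply: eq_bigr => i _; apply: eq_bigr => j _.
  rewrite pairE scaler_sumr; apply: eq_bigr => m _.
  by rewrite scaler_sumr; apply: eq_bigr => n _; rewrite scalerA.
transitivity (\sum_m \sum_n \sum_i \sum_j F m n i j).
  under eq_bigr do rewrite exchange_big /=.
  rewrite exchange_big /=; apply: eq_bigr => m _.
  under eq_bigr do rewrite exchange_big /=.
  by rewrite exchange_big.
rewrite /cform; apply: eq_bigr => m _; apply: eq_bigr => n _.
rewrite mxE scaler_suml exchange_big /=; apply: eq_bigr => j _.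
rewrite mxE big_distrl scaler_suml /=; apply: eq_bigr => i _.
by rewrite /F [_^T _ _]mxE mulrA [D i j * _]mulrC.
Qed.

Lemma cpair_wsub_unimodular u x i j : sub_mx u = 1%:M ->
  cpair (wsub u x i) (wsub u x j) = cpair (x i) (x j).
Proof. by move=> u1; rewrite -!cform_delta cform_wsub u1 trmx1 mul1mx mulmx1. Qed.

Lemma sub_mx_id : sub_mx (@wid k) = 1%:M.
Proof. by apply/matrixP => i j; rewrite mxE expo_wid !mxE eqxx eq_sym. Qed.

(** Lifts a form to a word, so that forms may occur inside substitutions. *)
Definition form_word D : word k :=
  flatten [seq flatten (nseq (D ij.1 ij.2) (wcomm (wid ij.1) (wid ij.2)))
          | ij <- index_enum ('I_k * 'I_k)%type].

Lemma eval_wcomm w1 w2 x :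
  eval_word (wcomm w1 w2) x = cval (cpair (eval_word w1 x) (eval_word w2 x)).
Proof. by rewrite /wcomm !eval_cat !eval_winv -mul_comm_cpair // !mulgA. Qed.

Lemma eval_form_word D x : eval_word (form_word D) x = cval (cform D x).
Proof.
rewrite eval_flatten /cform pair_big /= cval_sum.
by apply: eq_bigr => -[i j] _; rewrite eval_flatten_nseq eval_wcomm /= !mulg1 -cvalMn.
Qed.

Lemma expo_form_word D : expo (form_word D) = 0.
Proof.
by rewrite expo_flatten big1 // => ij _; rewrite expo_flatten_nseq expo_wcomm scaler0.
Qed.

End CommutatorForms.

(** * Collection and elementary substitutions *)

Section Collection.
Variables (gT : finGroupType) (k : nat).
Hypothesis class2 : nil_class [set: gT] <= 2.
Local Notation R := (expring gT).
Implicit Types (w : word k) (u v : 'I_k -> word k) (x y : tup gT k) (D : 'M[R]_k).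

Lemma cpair_eval2 w1 w2 x : cpair (eval_word w1 x) (eval_word w2 x) =
  cform ((expo gT w1)^T *m expo gT w2)%R x.
Proof.
rewrite cpair_eval //; apply: eq_bigr => i _.
rewrite cpairC cpair_eval // -sumrN scaler_sumr; apply: eq_bigr => j _.
by rewrite -scalerN -cpairC scalerA mxE big_ord1 !mxE.
Qed.

(** Merging two ordered products moves each power of the second past the tail of the first. The
    commutators created have exponents independent of [x]. *)
Lemma prod_expgD (a b : 'rV[R]_k) s : exists D, forall x,
  (\prod_(i <- s) x i ^+ a 0%R i) * (\prod_(i <- s) x i ^+ b 0%R i) =
  (\prod_(i <- s) x i ^+ (a + b)%R 0%R i) * cval (cform D x).
Proof.
elim: s => [|i s [D IH]].
  by exists 0%R => x; rewrite !big_nil mul1g cform0 mulg1.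
pose w1 := flatten [seq nseq (a 0%R j) (j, false) | j <- s].
pose w2 : word k := nseq (b 0%R i) (i, false).
(* The new term is the commutator of the tail [w1] of the first product with the power [w2] of [x_i]
   that crosses it. *)
exists (D + (expo gT w1)^T *m expo gT w2)%R => x.
rewrite !big_cons cformD cvalD -cpair_eval2 mxE expg_ZpD.
have -> : eval_word w1 x = \prod_(j <- s) x j ^+ a 0%R j.
  by rewrite eval_flatten; apply: eq_bigr => j _; rewrite eval_nseq.
rewrite eval_nseq; set F := \prod_(j <- s) _ in IH *; set g := x i ^+ b 0%R i.
rewrite mulgA -(mulgA (x i ^+ _)) (commute_cpair class2 F g) -!mulgA; do 2!congr (_ * _).
by rewrite [cval (cpair F g) * _]cvalC mulgA IH mulgA.
Qed.

Lemma eval_collect w : exists D, forall x,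
  eval_word w x = (\prod_i x i ^+ expo gT w 0%R i) * cval (cform D x).
Proof.
elim: w => [|l w [D IH]].
  exists 0%R => x; rewrite cform0 mulg1 big1 // => i _.
  by rewrite /expo big_nil mxE.
have [D' HD'] := prod_expgD (letter_expo gT l) (expo gT w) (index_enum 'I_k).
exists (D' + D)%R => x; rewrite /= IH cformD cvalD !mulgA; congr (_ * _).
rewrite -[l :: w]cat1s expo_cat {2}/expo big_seq1 -HD'; congr (_ * _).
(* The single letter is written as an ordered product over all indices, trivial away from [l.1]. *)
rewrite [RHS](eq_bigr (fun i => if i == l.1 then if l.2 then (x l.1)^-1 else x l.1 else 1)).
  by rewrite -big_mkcond big_pred1_eq.
move=> i _; rewrite /letter_expo; case: (eqVneq i l.1) => [->|/negPf il].
  case: l.2; rewrite !mxE !eqxx ?expg1 //.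
  by rewrite expg_ZpN expg1.
by case: l.2; rewrite !mxE il ?oppr0.
Qed.

Lemma eval_expo_eq w1 w2 : expo gT w1 = expo gT w2 ->
  exists D, forall x, eval_word w1 x = eval_word w2 x * cval (cform D x).
Proof.
move=> w12; have [D1 E1] := eval_collect w1; have [D2 E2] := eval_collect w2.
exists (- 1%R *: D2 + D1)%R => x; rewrite E1 E2 w12 -mulgA cformD cformZ -cvalD.
by rewrite scaleN1r addrA subrr add0r.
Qed.

(** The power of [x_a] comes first and [a] is skipped afterwards, so that in [wsub_elem_inj] the
    remaining factors, fixed by the substitution, cancel on the right. *)
Definition elem_word (a : 'I_k) (nu : 'rV[R]_k) : word k :=
  nseq (nu 0%R a) (a, false)
  ++ flatten [seq nseq (if j == a then 0 else nu 0%R j) (j, false) | j <- index_enum 'I_k].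

Definition elem_sub a nu i : word k := if i == a then elem_word a nu else wid i.

Lemma expo_elem_word a nu : expo gT (elem_word a nu) = nu.
Proof.
rewrite expo_cat expo_nseq natr_Zp expo_flatten [RHS]row_sum_delta.
rewrite (bigD1 a) //= [RHS](bigD1 a) //= eqxx; congr (_ + _)%R.
rewrite {1}/expo big_nil add0r; apply: eq_bigr => i /negPf ->.
by rewrite expo_nseq natr_Zp.
Qed.

Lemma wsub_elem_neq a nu x i : i != a -> wsub (elem_sub a nu) x i = x i.
Proof. by move=> /negPf ia; rewrite ffunE /elem_sub ia /= mulg1. Qed.

Lemma wsub_elem_inj a (nu : 'rV[R]_k) : nu 0%R a \is a GRing.unit ->
  injective (wsub (elem_sub a nu) : tup gT k -> _).
Proof.
move=> ua x y /ffunP xy.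
have eq_off i : i != a -> x i = y i.
  by move=> ia; have := xy i; rewrite !wsub_elem_neq.
apply/ffunP => i; have [-> {i}|/eq_off//] := eqVneq i a.
have := xy a; rewrite !ffunE /elem_sub eqxx !eval_cat !eval_nseq !eval_flatten.
rewrite [in RHS](eq_bigr
  (fun j => eval_word (nseq (if j == a then 0 else nu 0%R j) (j, false)) x)).
  by move=> /mulIg; apply: expg_Zp_inj.
by move=> j _; rewrite !eval_nseq; case: eqVneq => // /eq_off ->.
Qed.

Lemma sub_mx_elem a nu :
  sub_mx gT (elem_sub a nu) = (1%:M + delta_mx a 0 *m (nu - delta_mx 0 a) :> 'M[R]_k)%R.
Proof.
apply/matrixP => i j; rewrite !mxE big_ord1 !mxE eqxx andbT /elem_sub.
case: eqVneq => [->|_]; last by rewrite expo_wid mul0r addr0 mxE eqxx eq_sym.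
by rewrite expo_elem_word mul1r addrC [a == j]eq_sym subrK.
Qed.

(** [L] is the identity plus a matrix of rank at most one supported on row [a]; the product is
    expanded. *)
Lemma elem_congruence (M : 'M[R]_k) a nu i j (L := sub_mx gT (elem_sub a nu))
    (la := (nu - delta_mx 0 a)%R) :
  ((L^T *m M *m L) i j =
   M i j + la 0 i * M a j + M i a * la 0 j + la 0 i * M a a * la 0 j)%R.
Proof.
have LE : L = (1%:M + delta_mx a 0 *m la)%R by rewrite /L sub_mx_elem.
have LT : (L^T = 1%:M + la^T *m delta_mx 0 a)%R.
  by rewrite LE -[in RHS]trmx_delta -trmx_mul -[in RHS]trmx1; apply: raddfD.
rewrite LT {}LE mulmxDl mul1mx mulmxDr mulmx1.
have colE (N : 'M[R]_k) m n : ((N *m (delta_mx a 0 *m la)) m n = N m a * la 0 n)%R.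
  by rewrite mulmxA -colE mxE big_ord1 mxE.
have rowE (N : 'M[R]_k) m n : ((la^T *m delta_mx 0 a *m N) m n = la 0 m * N a n)%R.
  by rewrite -mulmxA -rowE mxE big_ord1 !mxE.
have addE m n : ((M + la^T *m delta_mx 0 a *m M) m n = M m n + la 0 m * M a n)%R.
  by rewrite mxE rowE.
by rewrite mxE colE !addE mulrDl !addrA.
Qed.

Definition shift_sub a D i : word k := if i == a then (a, false) :: form_word D else wid i.

Lemma wsub_shift a D x i :
  wsub (shift_sub a D) x i = if i == a then x i * cval (cform D x) else x i.
Proof.
by rewrite ffunE /shift_sub; case: eqP => [->|_] /=; rewrite ?eval_form_word ?mulg1.
Qed.

Lemma sub_mx_shift a D : sub_mx gT (shift_sub a D) = 1%:M%R.
Proof.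
rewrite -sub_mx_id; apply/matrixP => i j; rewrite !mxE /shift_sub.
case: eqP => // ->; rewrite -cat1s expo_cat expo_form_word addr0 expo_wid.
by rewrite -expo_wid.
Qed.

Lemma cform_shift a D E x : cform E (wsub (shift_sub a D) x) = cform E x.
Proof. by rewrite cform_wsub // sub_mx_shift trmx1 mul1mx mulmx1. Qed.

(** The central factor involves only commutators, which the shift does not change, so it can be
    recovered from the image and cancelled. *)
Lemma wsub_shift_inj a D : injective (wsub (shift_sub a D) : tup gT k -> _).
Proof.
move=> x y xy; apply/ffunP => i; have := congr1 (fun z : tup gT k => z i) xy.
rewrite /= !wsub_shift; case: eqP => // _.
by rewrite -(cform_shift a D D x) xy cform_shift => /mulIg.
Qed.

Lemma skew_congruence (L D : 'M[R]_k) :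
  skewpart (L^T *m D *m L)%R = (L^T *m skewpart D *m L)%R.
Proof. by rewrite /skewpart mulmxBr mulmxBl !trmx_mul trmxK mulmxA. Qed.

Definition supported (T : pred 'I_k) D := forall i j, ~~ (T i && T j) -> D i j = 0%R.

Lemma skew_supported T D : supported T D -> supported T (skewpart D).
Proof.
by move=> sD i j Tij; rewrite skewE !sD ?subr0 // andbC.
Qed.

(** Only [x_b] is replaced, by a combination chosen so that row [c] of the skew part becomes the
    unit row at [b]. *)
Lemma row_clear (T : pred 'I_k) D c b : c != b -> T c -> T b -> supported T D ->
  skewpart D c b \is a GRing.unit ->
  exists u D' (la : 'I_k -> R),
    [/\ injective (wsub u : tup gT k -> _),
        forall x i, i != b -> wsub u x i = x i,
        forall x, cform D (wsub u x) = cform D' x,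
        supported T D' &
      [/\ la c = 0%R,
          forall i j, skewpart D' i j =
            (skewpart D i j + la i * skewpart D b j + skewpart D i b * la j)%R &
          forall j, skewpart D' c j = (j == b)%:R%R]].
Proof.
move=> cb Tc Tb sD ucb; have sL := skew_supported sD.
(* Since [la c = 0], entry [(c, i)] becomes [skewpart D c i + skewpart D c b * la i]; [la] solves
   for the target value. The new exponent of [x_b] is then the inverse of the pivot, a unit. *)
pose la i := ((skewpart D c b)^-1 * ((i == b)%:R - skewpart D c i))%R.
pose nu : 'rV[R]_k := (\row_i la i + delta_mx 0 b)%R.
have laE i : (nu - delta_mx 0 b)%R 0%R i = la i by rewrite addrK mxE.
pose L := sub_mx gT (elem_sub b nu).
have la0 i : ~~ T i -> la i = 0%R.
  move=> Ti; rewrite /la (sL c i) ?(negPf Ti) ?andbF //.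
  by case: eqP Ti => [->|_ _]; rewrite ?Tb // subr0 mulr0.
have lac : la c = 0%R by rewrite /la (negPf cb) skew_diag subr0 mulr0.
have skE i j : skewpart (L^T *m D *m L)%R i j =
            (skewpart D i j + la i * skewpart D b j + skewpart D i b * la j)%R.
  by rewrite skew_congruence elem_congruence !laE skew_diag mulr0 mul0r addr0.
exists (elem_sub b nu), (L^T *m D *m L)%R, la; split.
- apply: wsub_elem_inj; rewrite !mxE !eqxx /la eqxx mulrBr mulr1 mulVr // subrK.
  by rewrite unitrV.
- by move=> x i; apply: wsub_elem_neq.
- by move=> x; rewrite cform_wsub.
- move=> i j; rewrite negb_and elem_congruence !laE => /orP[] Tk.
    by rewrite (la0 _ Tk) (sD i j) ?(sD i b) ?negb_and ?Tk // !mul0r !addr0.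
  by rewrite (la0 _ Tk) (sD i j) ?(sD b j) ?negb_and ?Tk ?orbT // !mulr0 !addr0.
split=> // j; rewrite skE lac mul0r addr0 /la mulVKr //.
by rewrite addrC subrK.
Qed.

End Collection.

(** * Normal form of a commutator form *)

Section NormalForm.
Variables (gT : finGroupType) (k p : nat).
Hypothesis class2 : nil_class [set: gT] <= 2.
Local Notation R := (expring gT).
Implicit Types (w : word k) (u v : 'I_k -> word k) (x y : tup gT k) (D : 'M[R]_k).
Local Open Scope ring_scope.

Hypothesis unit_or_dvd : forall a : R, a \is a GRing.unit \/ exists b, a = p%:R * b.

(** The edge [(a, b, s)] stands for the commutator [[x_a, x_b]] raised to [p^s]. *)
Definition edge := ('I_k * 'I_k * nat)%type.

Definition edge_sum (es : seq edge) x : center_mod gT :=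
  \sum_(e <- es) (p ^ e.2)%:R *: cpair (x e.1.1) (x e.1.2).

Fixpoint chain_edges (c : 'I_k) (ch : seq ('I_k * nat)) : seq edge :=
  if ch is (b, s) :: ch' then (c, b, s) :: chain_edges b ch' else [::].

Definition block_verts (bl : seq edge) : seq 'I_k :=
  flatten [seq [:: e.1.1; e.1.2] | e <- bl].

Lemma edge_sum_cons e es x :
  edge_sum (e :: es) x = (p ^ e.2)%:R *: cpair (x e.1.1) (x e.1.2) + edge_sum es x.
Proof. exact: big_cons. Qed.

Lemma edge_sum_cat es1 es2 x : edge_sum (es1 ++ es2) x = edge_sum es1 x + edge_sum es2 x.
Proof. exact: big_cat. Qed.

Definition restrict_mx (T : pred 'I_k) D : 'M[R]_k :=
  \matrix_(i, j) if T i && T j then D i j else 0.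

Lemma restrict_supported T D : supported T (restrict_mx T D).
Proof. by move=> i j /negPf Tij; rewrite mxE Tij. Qed.

Lemma skew_restrict T D i j :
  skewpart (restrict_mx T D) i j = if T i && T j then skewpart D i j else 0.
Proof.
by rewrite !skewE !mxE [T j && _]andbC; case: ifP => //; rewrite subr0.
Qed.

Lemma skew_delta a b i j : skewpart (delta_mx a b : 'M[R]_k) i j =
  ((i == a) && (j == b))%:R - ((j == a) && (i == b))%:R.
Proof. by rewrite skewE !mxE. Qed.

Lemma skewD D1 D2 : skewpart (D1 + D2) = skewpart D1 + skewpart D2.
Proof. by apply/matrixP => i j; rewrite !mxE opprD addrACA. Qed.

Lemma skew_dvd (T : pred 'I_k) D : supported T D ->
  (forall i j, T i -> T j -> exists b, skewpart D i j = p%:R * b) ->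
  exists2 D', supported T D' & skewpart D = skewpart (p%:R *: D').
Proof.
move=> sD dvdD; pose dvp a : R := odflt 0 [pick b | a == p%:R * b].
have dvpE a : (exists b, a = p%:R * b) -> p%:R * dvp a = a.
  move=> [b ab]; rewrite /dvp; case: pickP => [c /eqP // | /(_ b)].
  by rewrite ab eqxx.
(* Quotients by [p] are not unique, so they are chosen above the diagonal only; antisymmetry then
   determines the rest. *)
exists (\matrix_(i, j) if T i && T j && (i < j)%N then dvp (skewpart D i j) else 0).
  by move=> i j /negPf Tij; rewrite mxE Tij.
apply/matrixP => i j; rewrite [RHS]skewE !mxE [T j && T i]andbC.
have [/andP[Ti Tj]|nT] := boolP (T i && T j); last first.
  by rewrite !sD ?subr0 ?mulr0 ?subr0 // andbC.
rewrite /= -!skewE; case: (ltngtP i j) => [ij|ji|/val_inj->].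
- by rewrite mulr0 subr0 dvpE //; apply: dvdD.
- by rewrite mulr0 sub0r dvpE ?[LHS]skewN //; apply: dvdD.
- by rewrite mulr0 subr0 skew_diag.
Qed.

(** [S] holds the free vertices, [c] is the end of the chain and [fl] tells whether the chain may
    grow. Each case lowers [#|S| + (r - t)]. Coordinates outside [S] stay fixed, so edges already
    split off survive later substitutions. *)
Lemma normal_form r n (S : {set 'I_k}) (c : 'I_k) (fl : bool) t D :
  (#|S| + (r - t) <= n)%N -> (t <= r)%N -> (fl -> c \notin S) ->
  supported (fun i => (i \in S) || fl && (i == c)) D ->
  exists u ch bl E,
    [/\ injective (wsub u : tup gT k -> _),
        forall x i, i \notin S -> wsub u x i = x i,
        forall x, (p ^ t)%:R *: cform D (wsub u x) =
          edge_sum (chain_edges c ch ++ bl) x + (p ^ r)%:R *: cform E x,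
        uniq (block_verts bl ++ map fst ch) &
     [/\ all [in S] (block_verts bl ++ map fst ch),
        sorted ltn (map snd ch), all (fun e => t <= e < r)%N (map snd ch),
        all (fun e => e.2 < r)%N bl & ~~ fl -> ch = [::]]].
Proof.
(* At [t = r] the identity substitution works: the whole form is the remainder [E]. *)
elim: n S c fl t D => [|n IH] S c fl t D le_n; rewrite leq_eqVlt => /orP[/eqP->|lt_tr] cS sD;
  try by exists (@wid k), [::], [::], D; split; rewrite ?wsub_id //= => x;
    [move=> y; rewrite !wsub_id | move=> i; rewrite wsub_id |
     rewrite wsub_id /edge_sum big_nil add0r].
  by move: le_n; rewrite leqn0 addn_eq0 subn_eq0 leqNgt lt_tr andbF.
set T := (fun i => _) in sD.
have TS i : i \in S -> T i by rewrite /T => ->.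
have le_tS : (r - t.+1 < r - t)%N by rewrite ltn_sub2l.
(* A unit inside [S]: clearing rows [a] and [b] in turn splits off a block avoiding [c]. *)
have [/exists_inP[a Sa /exists_inP[b Sb uab]]|nSS] :=
  boolP [exists a in S, exists b in S, skewpart D a b \is a GRing.unit].
  have ab : a != b.
    by apply: contraTneq uab => ->; rewrite skew_diag unitr0.
  have [u1 [D1 [la1 [inj1 fix1 E1 s1 [_ _ row1]]]]] :=
    row_clear class2 ab (TS a Sa) (TS b Sb) sD uab.
  have uba : skewpart D1 b a \is a GRing.unit.
    by rewrite skewN row1 eqxx unitrN unitr1.
  have ba : b != a by rewrite eq_sym.
  have [u2 [D2 [la2 [inj2 fix2 E2 s2 [_ sk2 row2]]]]] :=
    row_clear class2 ba (TS b Sb) (TS a Sa) s1 uba.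
  pose S' := S :\ a :\ b.
  pose T' := (fun i => (i \in S') || fl && (i == c)).
  have [||u3 [ch [bl [E [inj3 fix3 E3 uq [inS srt rng blr cfl]]]]]] :=
    IH S' c fl t (restrict_mx T' D2) _ (ltnW lt_tr) _ (@restrict_supported _ _).
  - have := cardsD1 a S; have := cardsD1 b (S :\ a).
    rewrite !inE Sa Sb eq_sym ab -/S' /= => -> S_eq.
    by move: le_n; rewrite S_eq !addSn ltnS => /ltnW.
  - by move/cS => cS'; rewrite !inE (negPf cS') !andbF.
  have [aS' bS'] : a \notin S' /\ b \notin S' by rewrite !inE !eqxx andbF.
  have skD2 : skewpart D2 = skewpart (delta_mx b a + restrict_mx T' D2).
    have nTc i : T i -> ~~ T' i -> i = a \/ i = b.
      rewrite /T /T' !inE; case: (eqVneq i a) => [|_]; first by left.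
      by case: (eqVneq i b) => [|_ /= ->//]; first by right.
    (* The second clearing changes row [a] only by a multiple of itself, so it stays concentrated at
       [b]. *)
    have rowa j : j != b -> skewpart D2 a j = 0.
      move=> /negPf jb; rewrite sk2 row1 jb skew_diag mulr0 mul0r.
      by rewrite !addr0.
    have rowb j : j != a -> skewpart D2 b j = 0.
      by move=> /negPf ja; rewrite row2 ja.
    have sS2 := skew_supported s2.
    have T'a : T' a = false.
      rewrite /T' (negPf aS') /=; apply/negbTE/negP => /andP[/cS + /eqP ac].
      by rewrite -ac Sa.
    have T'b : T' b = false.
      rewrite /T' (negPf bS') /=; apply/negbTE/negP => /andP[/cS + /eqP bc].
      by rewrite -bc Sb.
    have half i j : ~~ T' i -> skewpart D2 i j = skewpart (delta_mx b a) i j.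
      move=> nTi; rewrite skew_delta.
      have [Ti|nTT] := boolP (T i); last first.
        rewrite sS2 ?negb_and ?nTT //.
        have /negPf-> : i != b by apply: contraNneq nTT => ->; apply: TS.
        have /negPf-> : i != a by apply: contraNneq nTT => ->; apply: TS.
        by rewrite andbF subr0.
      case: (nTc i Ti nTi) => ->.
        rewrite eqxx (negPf ab) /= sub0r andbT; case: (eqVneq j b) => [->|/rowa->].
          by rewrite skewN row2 eqxx.
        by rewrite oppr0.
      rewrite eqxx (negPf ba) /= andbF subr0; case: (eqVneq j a) => [->|/rowb->] //.
      by rewrite row2 eqxx.
    apply/matrixP => i j.
    rewrite skewD [RHS]mxE skew_restrict; case: ifP => [/andP[Ti Tj]|].
      have ni z : T' z -> ((z == a = false) * (z == b = false))%type.
        by move=> Tz; split; apply: contraTF Tz => /eqP ->; rewrite ?T'a ?T'b.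
      by rewrite skew_delta !(ni _ Ti) !(ni _ Tj) andbF subr0 add0r.
    move/negbT; rewrite negb_and addr0 => /orP[nT|nT]; first exact: half.
    by rewrite skewN half // -skewN.
  exists (fun i => wcomp u3 (wcomp u2 (u1 i))), ch, ((b, a, t) :: bl), E.
  have uE x : wsub (fun i => wcomp u3 (wcomp u2 (u1 i))) x = wsub u1 (wsub u2 (wsub u3 x)).
    by rewrite !wsub_comp; apply/ffunP => i; rewrite !ffunE !eval_wcomp.
  split.
  - by move=> x y; rewrite !uE => /inj1/inj2/inj3.
  - move=> x i iS; have [ia ib] : i != a /\ i != b.
      by split; apply: contraNneq iS => ->.
    by rewrite uE fix1 // fix2 // fix3 // !inE (negPf iS) !andbF.
  - move=> x; rewrite uE E1 E2 (cform_skew _ skD2) // cformD scalerDr E3 cform_delta //.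
    by rewrite !fix3 // !edge_sum_cat edge_sum_cons /= !addrA [edge_sum _ _ + _]addrC.
  - have nin z : z \notin S' -> z \notin block_verts bl ++ [seq i.1 | i <- ch].
      by apply: contraNN => /(allP inS).
    by rewrite /= inE (negPf ba) /= !nin.
  split=> //=; last by rewrite lt_tr.
  rewrite Sa Sb /=; apply: sub_all inS => z; rewrite !inE.
  by case/andP=> _ /andP[].
have dvSS i j : i \in S -> j \in S -> exists b, skewpart D i j = p%:R * b.
  move=> Si Sj; case: (unit_or_dvd (skewpart D i j)) => // uij.
  case/negP: nSS; apply/exists_inP; exists i => //; apply/exists_inP.
  by exists j.
have [/andP[fl1 /exists_inP[b Sb ucb]]|nfl] :=
  boolP (fl && [exists b in S, skewpart D c b \is a GRing.unit]).
  have cS1 := cS fl1.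
  have cb : c != b by apply: contraNneq cS1 => ->.
  have Tc : T c by rewrite /T fl1 eqxx orbT.
  have [u1 [D1 [la1 [inj1 fix1 E1 s1 [lac sk1 row1]]]]] :=
    row_clear class2 cb Tc (TS b Sb) sD ucb.
  have [|D2 s2 skD2] := @skew_dvd [in S] _ (@restrict_supported [in S] D1).
    (* Clearing row [c] alters entries inside [S] by multiples of entries inside [S]. All of these
       are divisible by [p], as no unit was found there. *)
    move=> i j /= Si Sj; rewrite skew_restrict /= Si Sj /= sk1.
    have [x1 ->] := dvSS i j Si Sj; have [x2 ->] := dvSS b j Sb Sj.
    have [x3 ->] := dvSS i b Si Sb.
    by exists (x1 + la1 i * x2 + x3 * la1 j); rewrite !mulrDr mulrCA !mulrA.
  (* The new chain end [b] leaves [S] but stays in the support; passing to level [t.+1] makes later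
     chain exponents strictly larger. *)
  pose S' := S :\ b.
  have [||||u3 [ch [bl [E [inj3 fix3 E3 uq [inS srt rng blr cfl]]]]]] :=
    IH S' b true t.+1 D2.
  - have := cardsD1 b S; rewrite Sb -/S' => S_eq.
    move: le_n; rewrite S_eq addSn ltnS; apply: leq_trans.
    by rewrite leq_add2l ltnW.
  - exact: lt_tr.
  - by rewrite !inE eqxx.
  - move=> i j /=; rewrite !inE => nij; apply: s2; apply: contraNN nij.
    by move=> /andP[-> ->]; rewrite !andbT !orNb.
  have bS' : b \notin S' by rewrite !inE eqxx.
  have cS' : c \notin S' by rewrite !inE (negPf cS1) andbF.
  have skD1 : skewpart D1 = skewpart (delta_mx c b + p%:R *: D2).
    rewrite skewD -skD2; apply/matrixP => i j; rewrite [RHS]mxE skew_restrict /=.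
    have half i' j' : i' \notin S -> skewpart D1 i' j' = skewpart (delta_mx c b) i' j'.
      move=> iS; have /negPf ib : i' != b by apply: contraNneq iS => ->.
      rewrite skew_delta ib andbF subr0.
      case: (eqVneq i' c) => [->|/negPf ic]; first by rewrite row1.
      by rewrite (skew_supported s1) // /T (negPf iS) ic andbF.
    case: ifP => [/andP[Si Sj]|].
      have ni z : z \in S -> (z == c) = false by apply: contraTF => /eqP ->.
      by rewrite skew_delta !ni // subr0 add0r.
    move/negbT; rewrite negb_and addr0 => /orP[nT|nT]; first exact: half.
    by rewrite skewN half // -skewN.
  exists (fun i => wcomp u3 (u1 i)), ((b, t) :: ch), bl, E.
  have uE x : wsub (fun i => wcomp u3 (u1 i)) x = wsub u1 (wsub u3 x).
    by rewrite wsub_comp.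
  split.
  - by move=> x y; rewrite !uE => /inj1/inj3.
  - move=> x i iS; have ib : i != b by apply: contraNneq iS => ->.
    by rewrite uE fix1 // fix3 // !inE (negPf iS) !andbF.
  - move=> x; rewrite uE E1 (cform_skew _ skD1) // cformD scalerDr cform_delta //.
    rewrite !fix3 // cformZ scalerA -natrM -expnSr E3.
    by rewrite /= edge_sum_cons /= !addrA.
  - have nin : b \notin block_verts bl ++ [seq i.1 | i <- ch].
      by apply: contraNN bS' => /(allP inS).
    by rewrite /= uniq_catC /= uniq_catC uq andbT mem_cat orbC -mem_cat.
  split=> //=; last by rewrite fl1.
  - rewrite all_cat /= Sb /= -all_cat; apply: sub_all inS => z.
    by rewrite !inE => /andP[].
  - rewrite path_min_sorted //; apply: sub_all rng => e /andP[+ _].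
    by [].
  - rewrite leqnn lt_tr /=; apply: sub_all rng => e /andP[/ltnW-> ->] //.
(* No pivot at level [t]: the whole skew part is divisible by [p]. *)
have [|D2 s2 skD2] := skew_dvd sD.
  move=> i j; rewrite /T => /orP[Si|/andP[f1 /eqP->]] /orP[Sj|/andP[f2 /eqP->]].
  - exact: dvSS.
  - rewrite skewN; case: (unit_or_dvd (skewpart D c i)) => [uci|[b ->]].
      by case/negP: nfl; rewrite f2; apply/exists_inP; exists i.
    by exists (- b); rewrite mulrN.
  - case: (unit_or_dvd (skewpart D c j)) => // ucj.
    by case/negP: nfl; rewrite f1; apply/exists_inP; exists j.
  - by exists 0; rewrite skew_diag mulr0.
have [||//|u3 [ch [bl [E [inj3 fix3 E3 uq [inS srt rng blr cfl]]]]]] :=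
    IH S c fl t.+1 D2 _ _ _ s2.
- by rewrite -ltnS; apply: leq_trans le_n; rewrite ltn_add2l.
- exact: lt_tr.
exists u3, ch, bl, E; split=> //; first move=> x.
  by rewrite (cform_skew _ skD2) // cformZ scalerA -natrM -expnSr E3.
split=> //; apply: sub_all rng => e /andP[/ltnW-> ->] //.
Qed.

End NormalForm.

(** * Reading a normal form as a word [vp] *)

Section Relabelling.
Variables (gT : finGroupType) (k p : nat).
Hypothesis class2 : nil_class [set: gT] <= 2.
Local Notation I := 'I_k.+1.
Implicit Types (x : tup gT k.+1) (ch : seq (I * nat)) (bl : seq (edge k.+1)).

Definition vp_index (l n : nat) : seq nat :=
  iota 1%N l.-1 ++ [seq j <- iota l (n - l) | ~~ odd (j - l)].

Lemma eval_vp t0 l n s x : 0 < l ->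
  eval_word (vp k p t0 l n s) x =
  x ord0 ^+ t0 *
  cval (edge_sum p [seq (inord i.-1, inord i, s i) | i <- vp_index l n] x).
Proof.
move=> l_gt0; rewrite /vp !eval_cat; congr (_ * _).
  rewrite /xgen eval_nseq; congr (x _ ^+ _).
  by apply: val_inj; rewrite /= inordK.
rewrite -eval_cat -flatten_cat -map_cat eval_flatten /edge_sum big_map cval_sum.
apply: eq_bigr => i _.
by rewrite eval_flatten_nseq eval_wcomm // scaler_nat cvalMn /= !mulg1.
Qed.

Lemma filter_even_iota l d :
  [seq j <- iota l d | ~~ odd (j - l)] = [seq l + i.*2 | i <- iota 0 (uphalf d)].
Proof.
elim/ltn_ind: d l => -[|[|d]] IH l //=; first by rewrite subnn /= double0 addn0.
rewrite subnn subSnn /= double0 addn0; congr (_ :: _).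
have -> : [seq j <- iota l.+2 d | ~~ odd (j - l)] = [seq j <- iota l.+2 d | ~~ odd (j - l.+2)].
  apply: eq_in_filter => j; rewrite mem_iota => /andP[lj _].
  by rewrite -{1}(subnKC lj) -addn2 -addnA addKn oddD.
rewrite IH // -[1%N]/(1 + 0)%N iotaDl -map_comp; apply: eq_map => i /=.
by rewrite doubleD !addSn addnS addnS.
Qed.

(** The arbitrary tails [R] and [R'] allow the chain to be read off inside the full vertex and
    exponent lists. *)
Lemma chain_edges_nth d c ch R R' :
  [seq (nth d (c :: map fst ch ++ R) i, nth d (c :: map fst ch ++ R) i.+1,
        nth 0 (map snd ch ++ R') i) | i <- iota 0 (size ch)] = chain_edges c ch.
Proof.
elim: ch c => //= -[b s] ch IH c /=; congr (_ :: _).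
by rewrite -[RHS](IH b) -[1%N]/(1 + 0)%N iotaDl -map_comp.
Qed.

(** Disjoint blocks use every other index of [s] only; the skipped ones are padded with 0. *)
Definition block_exps bl : seq nat := flatten [seq [:: e.2; 0] | e <- bl].

Lemma blocks_nth d bl :
  [seq (nth d (block_verts bl) i.*2, nth d (block_verts bl) i.*2.+1,
        nth 0 (block_exps bl) i.*2) | i <- iota 0 (size bl)] = bl.
Proof.
elim: bl => //= -[[a b] s] bl IH; congr (_ :: _).
by rewrite -[RHS]IH -[1%N]/(1 + 0)%N iotaDl -map_comp.
Qed.

Lemma size_block_verts bl : size (block_verts bl) = (size bl).*2.
Proof. by elim: bl => //= e bl ->; rewrite doubleS. Qed.

Lemma chain_edges_rcons c ch b s :
  chain_edges c (rcons ch (b, s)) = rcons (chain_edges c ch) (last c (map fst ch), b, s).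
Proof. by elim: ch c => //= -[b' s'] ch IH c /=; rewrite IH. Qed.

(** Completing [L] to an enumeration of all indices turns positions into a permutation. *)
Lemma relabel (L : seq I) d : uniq L ->
  exists2 f : I -> I, injective f & forall j, j < size L -> f (nth d L j) = inord j.
Proof.
move=> uL; pose L' := L ++ [seq i <- enum I | i \notin L].
have memL' i : i \in L' by rewrite mem_cat mem_filter mem_enum andbT orbN.
have uL' : uniq L'.
  rewrite cat_uniq uL filter_uniq ?enum_uniq // andbT.
  by apply/hasPn => i; rewrite mem_filter => /andP[].
have sL' : size L' = k.+1.
  rewrite -(card_uniqP uL') -[RHS](card_ord k.+1).
  by apply: eq_card => i; rewrite memL'.
exists (fun i => inord (index i L')).
  have lt_index i : index i L' < k.+1 by rewrite -[X in _ < X]sL' index_mem.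
  move=> i j /(congr1 val); rewrite /= !inordK //.
  by move=> ij; rewrite -(nth_index d (memL' i)) ij nth_index ?memL'.
move=> j lt_j; congr inord; have -> : nth d L j = nth d L' j by rewrite nth_cat lt_j.
by rewrite index_uniq // size_cat ltn_addr.
Qed.

Lemma wsub_relabel_inj (f : I -> I) : injective f ->
  injective (wsub (fun i => wid (f i)) : tup gT k.+1 -> _).
Proof.
move=> /injF_bij[g fK gK] x y /ffunP xy; apply/ffunP => i.
by have := xy (g i); rewrite !ffunE /= !mulg1 gK.
Qed.

(** In [vp] the second product begins with [[x_l, x_(l+1)]], sharing [x_l] with the chain. Hence the
    first block of [bl'] starts at the last chain vertex. *)
Lemma normal_form_vp c ch v e bl
    (bl' := (last c (map fst ch), v, e) :: bl)
    (s := fun i => nth 0 (map snd ch ++ block_exps bl') i.-1)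
    (n := size ch + (size bl').*2) :
  uniq (c :: map fst ch ++ v :: block_verts bl) ->
  n <= k.+1 /\
  exists2 u, injective (wsub u : tup gT k.+1 -> _) & forall t0 x,
    wsub u x c ^+ t0 * cval (edge_sum p (chain_edges c ch ++ bl') (wsub u x)) =
    eval_word (vp k p t0 (size ch).+1 n s) x.
Proof.
set L := c :: _ => uL.
have sL : size L = n.
  by rewrite /= size_cat /= size_map size_block_verts /n /= doubleS !addnS.
have LE : L = belast c (map fst ch) ++ block_verts bl'.
  by rewrite /L -cat_cons lastI cat_rcons.
split; first by rewrite -sL -[X in _ <= X]card_ord -(card_uniqP uL) max_card.
have [f inj_f fE] := relabel c uL.
exists (fun i => wid (f i)); first exact: wsub_relabel_inj.
move=> t0 x; have subE i : wsub (fun i => wid (f i)) x i = x (f i).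
  by rewrite ffunE /= mulg1.
rewrite eval_vp // subE -[c in f c]/(nth c L 0) fE //.
have -> : inord 0 = ord0 :> I by apply: val_inj; rewrite /= inordK.
congr (_ * cval _).
have -> : chain_edges c ch ++ bl' =
    [seq (nth c L i.-1, nth c L i, s i) | i <- vp_index (size ch).+1 n].
  rewrite map_cat -[iota 1%N _]/(iota (1 + 0)%N _) iotaDl -map_comp; congr (_ ++ _).
    by rewrite -[LHS](chain_edges_nth c c ch (v :: block_verts bl) (block_exps bl')).
  (* This odd length, rounded up after halving, gives one index per block. *)
  have -> : n - (size ch).+1 = (size bl').*2.-1 by rewrite subnS /n addKn.
  rewrite filter_even_iota uphalfE prednK // doubleK -[LHS](blocks_nth c) -map_comp.
  apply: eq_map => i /=; rewrite addSn /= LE.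
  have shift (T : Type) (d : T) A B j m : size A = m -> nth d (A ++ B) (m + j) = nth d B j.
    by move=> <-; rewrite nth_cat ltnNge leq_addr /= addKn.
  by rewrite /s /= !(shift _ _ _ _ _ (size ch)) ?size_belast ?size_map.
rewrite /edge_sum !big_map big_seq [RHS]big_seq; apply: eq_bigr => i.
rewrite mem_cat mem_filter !mem_iota => ri; rewrite /= !subE.
have [i_gt0 i_lt] : 0 < i /\ i < size L.
  have le_ln : (size ch).+1 <= n by rewrite /n /= doubleS !addnS ltnS leqW ?leq_addr.
  rewrite sL; case/orP: ri => [/andP[i1 i2]|/andP[_ /andP[i1 i2]]].
    by split=> //; apply: leq_trans le_ln.
  by split; [apply: leq_trans i1 | rewrite subnKC in i2].
by rewrite !fE // prednK // ltnW.
Qed.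

End Relabelling.

(** * Normal forms of word maps *)

Section Equivalence.
Variables (gT : finGroupType) (k : nat).
Implicit Types f g h : tup gT k -> gT.

(** Stated for arbitrary functions on tuples, so that intermediate normal forms need not be
    presented as words. *)
Definition sub_equiv f g :=
  exists2 u, injective (wsub u : tup gT k -> _) & forall x, f (wsub u x) = g x.

Lemma sub_equiv_trans f g h : sub_equiv f g -> sub_equiv g h -> sub_equiv f h.
Proof.
move=> [u inj_u fg] [v inj_v gh]; exists (fun i => wcomp v (u i)) => [x y|x].
  by rewrite -!wsub_comp => /inj_u/inj_v.
by rewrite -wsub_comp fg gh.
Qed.

Lemma sub_equiv_sym f g : sub_equiv f g -> sub_equiv g f.
Proof.
move=> [u inj_u fg]; have [v [inj_v uK vK]] := wsub_inverse inj_u.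
by exists v => // x; rewrite -fg vK.
Qed.

Lemma sub_equiv_automorphic w1 w2 :
  sub_equiv (eval_word w1) (eval_word w2) -> Fk_automorphic gT w1 w2.
Proof. by case=> u; apply: substitution_automorphic. Qed.

End Equivalence.

(** * Normal forms over a group of order [p^N] *)

Section PGroup.
Variables (gT : finGroupType) (k p N : nat).
Hypothesis class2 : nil_class [set: gT] <= 2.
Hypotheses (p_pr : prime p) (N_gt0 : 0 < N) (cardG : #|[set: gT]| = (p ^ N)%N).
Local Notation R := (expring gT).
Implicit Types (w : word k.+1) (x : tup gT k.+1) (D : 'M[R]_k.+1).

Let q_gt1 : 1 < #|[set: gT]|.
Proof. by rewrite cardG -(exp1n N) ltn_exp2r // prime_gt1. Qed.

Lemma expring_unit_or_dvd (a : R) : a \is a GRing.unit \/ exists b, (a = p%:R * b)%R.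
Proof.
have [co|] := boolP (coprime p a).
  by left; rewrite -[a]natr_Zp unitZpE // [X in coprime X _]cardG coprime_pexpl.
rewrite prime_coprime // negbK => /divnK pa; right; exists (a %/ p)%:R%R.
by rewrite -natrM mulnC pa natr_Zp.
Qed.

Lemma expring_expN : ((p ^ N)%:R = 0 :> R)%R.
Proof. by rewrite -cardG; apply: pchar_Zp. Qed.

Lemma row_content (a : 'rV[R]_k.+1) : exists t i b,
  [/\ t <= N, a = ((p ^ t)%:R *: b)%R & b 0%R i \is a GRing.unit].
Proof.
suff H m : m <= N -> forall b, a = ((p ^ (N - m))%:R *: b)%R -> exists t i b',
    [/\ t <= N, a = ((p ^ t)%:R *: b')%R & b' 0%R i \is a GRing.unit].
  by apply: (H N (leqnn N) a); rewrite subnn scale1r.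
elim: m => [_ b|m IH m_lt b aE].
  rewrite subn0 expring_expN scale0r => ->.
  (* The row is zero and [p^N = 0] in [R], so any row with a unit entry serves. *)
  exists N, ord0, (delta_mx 0 0)%R.
  by rewrite leqnn expring_expN scale0r mxE !eqxx unitr1.
have [/existsP[i ui]|nu] := boolP [exists i, b 0%R i \is a GRing.unit].
  by exists (N - m.+1), i, b; rewrite leq_subr.
pose dvp (c : R) : R := odflt 0%R [pick d | c == p%:R * d]%R.
have bE : b = (p%:R *: \row_i dvp (b 0 i))%R.
  apply/rowP => i; rewrite !mxE /dvp; case: pickP => [d /eqP //|nd].
  case: (expring_unit_or_dvd (b 0%R i)) => [ui|[d bd]].
    by case/negP: nu; apply/existsP; exists i.
  by have := nd d; rewrite -bd eqxx.
apply: (IH (ltnW m_lt) (\row_i dvp (b 0%R i))%R).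
by rewrite aE {1}bE scalerA -natrM -expnSr subnSK.
Qed.

(** Up to a commutator form, [w] is the [p^t]-th power of [elem_word i b], and the inverse of an
    elementary substitution turns that word into [x_i]. *)
Lemma eval_power_form w : exists t i D, t <= N /\
  sub_equiv (eval_word w) (fun x => x i ^+ (p ^ t) * cval (cform D x)).
Proof.
have [t [i [b [le_tN wE ub]]]] := row_content (expo gT w).
pose u := elem_sub i b; pose w' := flatten (nseq (p ^ t) (elem_word i b)).
have [v [inj_v uK vK]] := wsub_inverse (wsub_elem_inj ub).
have [|D DE] := @eval_expo_eq _ _ class2 w w'.
  by rewrite expo_flatten_nseq expo_elem_word.
pose L := sub_mx gT v; exists t, i, (L^T *m D *m L)%R; split=> //; exists v => // x.
rewrite DE cform_wsub // eval_flatten_nseq; congr (_ ^+ _ * _).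
by rewrite -[in RHS](vK x) [RHS]ffunE /elem_sub eqxx.
Qed.

Lemma edge_sum_shift a D (es : seq (edge k.+1)) x :
  edge_sum p es (wsub (shift_sub a D) x) = edge_sum p es x.
Proof.
apply: eq_bigr => e _; congr (_ *: _)%R.
by apply: cpair_wsub_unimodular; rewrite ?sub_mx_shift.
Qed.

Definition edge_form t i es x : gT := x i ^+ (p ^ t) * cval (edge_sum p es x).

Lemma power_form_normal r i D : exists ch bl,
  [/\ sub_equiv (fun x => x i ^+ (p ^ r) * cval (cform D x))
                (edge_form r i (chain_edges i ch ++ bl)),
      uniq (i :: block_verts bl ++ map fst ch), sorted ltn (map snd ch),
      all (fun e => e < r) (map snd ch) & all (fun e => e.2 < r) bl].
Proof.
have [|//||i1 j1|u [ch [bl [E [inj_u fix_u uE uq [inS srt rng blr _]]]]]] :=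
  @normal_form gT k.+1 p class2 expring_unit_or_dvd r (#|[set~ i]| + (r - 0))
    [set~ i] i true 0 D.
- by [].
- by rewrite !inE eqxx.
- by rewrite !inE !orNb.
exists ch, bl; split=> //.
(* As [cform E x] is central, [x_i^(p^r)] times its [p^r]-th power equals [(x_i * cform E x)^(p^r)];
   a shift of [x_i] removes the remainder. *)
- pose g x := edge_form r i (chain_edges i ch ++ bl) (wsub (shift_sub i E) x).
  apply: (@sub_equiv_trans _ _ _ g).
    exists u => // x; rewrite /g /edge_form edge_sum_shift wsub_shift // eqxx.
    have := uE x; rewrite scale1r => ->; rewrite fix_u ?inE ?eqxx // cvalD scaler_nat.
    rewrite cvalMn expgMn; last exact/commute_sym/cvalC.
    by rewrite -!mulgA; congr (_ * _); apply: cvalC.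
  by apply: sub_equiv_sym; exists (shift_sub i E) => //; apply: wsub_shift_inj.
- rewrite /= uq andbT; apply/negP => /(allP inS).
  by rewrite !inE eqxx.
Qed.

Lemma edge_form_nil t i : sub_equiv (edge_form t i [::])
  (eval_word (vp k p (p ^ t) 1 1 (fun _ => 0))).
Proof.
have [f inj_f fE] := @relabel k [:: i] i isT.
exists (fun j => wid (f j)); first exact: wsub_relabel_inj.
move=> x; rewrite eval_vp // /edge_form /edge_sum !big_nil; congr (_ ^+ _ * _).
rewrite ffunE /= mulg1 -[i in f i]/(nth i [:: i] 0) fE //; congr (x _).
by apply: val_inj; rewrite /= inordK.
Qed.

(* In [vp] with [n > 1] the first generator always occurs in a commutator, so an
   isolated [x_i] has to be attached to a block: replace [x_b] by [x_b x_i^-1]. *)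
Lemma attach_block t i a b e bl : uniq [:: i, a, b & block_verts bl] ->
  sub_equiv (edge_form t i ((a, b, e) :: bl))
            (edge_form t i [:: (i, a, e), (a, b, e) & bl]).
Proof.
move=> uq; pose u j : word k.+1 := if j == b then [:: (b, false); (i, true)] else wid j.
have uE x j : wsub u x j = if j == b then x b * (x i)^-1 else x j.
  by rewrite ffunE /u; case: eqP => _ /=; rewrite !mulg1.
move: uq; rewrite /= !inE !negb_or -!andbA => /and4P[/negPf ia /negPf ib ibl].
move=> /and4P[/negPf ab abl bbl _].
exists u => [x y /ffunP xy|x].
  have off j : j != b -> x j = y j.
    by move=> /negPf jb; have := xy j; rewrite !uE jb.
  apply/ffunP => j; have [->|/off //] := eqVneq j b.
  have := xy b; rewrite !uE eqxx (off i) ?ib //; exact: mulIg.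
rewrite /edge_form uE ib; congr (_ * cval _); rewrite !edge_sum_cons /= !uE eqxx ab.
rewrite cpairMr // [cpair _ (x i)^-1]cpairC cpairVl // opprK scalerDr.
rewrite [X in (X + _ = _)%R]addrC -addrA; congr (_ + (_ + _))%R.
apply: eq_big_seq => d dbl; have mem z : z \in [:: d.1.1; d.1.2] -> z \in block_verts bl.
  by move=> zd; apply/flattenP; exists [:: d.1.1; d.1.2] => //; apply: map_f.
rewrite !uE !ifN //.
  by apply: contraNneq bbl => <-; apply: mem; rewrite !inE eqxx orbT.
by apply: contraNneq bbl => <-; apply: mem; rewrite !inE eqxx.
Qed.

(** Padding zeros and the default value of [nth] are below [r] because [r > 0]. *)
Lemma normal_exps_lt r (ch : seq ('I_k.+1 * nat)) (bl : seq (edge k.+1)) j :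
  0 < r -> all (fun e => e < r) (map snd ch) -> all (fun e => e.2 < r) bl ->
  nth 0 (map snd ch ++ block_exps bl) j < r.
Proof.
move=> r_gt0 chr blr; set s := _ ++ _.
suff /all_nthP all_s : all (fun e => e < r) s.
  by have [/all_s //|le_s] := ltnP j (size s); rewrite nth_default.
rewrite all_cat chr /=; elim: bl blr {s} => //= e bl IH /andP[-> /IH->].
by rewrite r_gt0.
Qed.

Definition has_vp_form w : Prop :=
  exists (r l n : nat) (s : nat -> nat),
    0 < r /\ 1 <= l /\ l <= n /\ n <= k.+1 /\
    (forall i, 1 <= i -> i.+1 <= l.-1 -> s i < s i.+1) /\
    (1 < l -> s l.-1 < r) /\
    (forall j, l <= j -> j <= n.-1 -> s j < r) /\
    Fk_automorphic gT w (vp k p (p ^ r) l n s).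

Lemma chain_vp_form w r i ch v e bl (bl' := (last i (map fst ch), v, e) :: bl) :
  0 < r -> sub_equiv (eval_word w) (edge_form r i (chain_edges i ch ++ bl')) ->
  uniq (i :: map fst ch ++ v :: block_verts bl) -> sorted ltn (map snd ch) ->
  all (fun e => e < r) (map snd ch) -> all (fun e => e.2 < r) bl' -> has_vp_form w.
Proof.
move=> r_gt0 eqv uq srt chr blr.
have [le_n [u inj_u uE]] := @normal_form_vp gT k p class2 i ch v e bl uq.
have s_lt j : nth 0 (map snd ch ++ block_exps bl') j.-1 < r.
  exact: normal_exps_lt.
exists r, (size ch).+1, (size ch + (size bl').*2),
  (fun j => nth 0 (map snd ch ++ block_exps bl') j.-1).
do 3!split=> //; first by rewrite /= doubleS !addnS ltnS leqW ?leq_addr.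
split; first exact: le_n.
split.
  move=> j j_gt0 /= j_lt; rewrite !(nth_cat _ (map snd ch)) size_map j_lt.
  rewrite prednK // (ltnW j_lt).
  by move/(sortedP 0): srt => /(_ j.-1); rewrite size_map prednK //; apply.
do 2!split=> //; apply: sub_equiv_automorphic; apply: sub_equiv_trans eqv _.
by exists u => // x; apply: uE.
Qed.

Lemma noncommutator_normal_form w : Pw_constant gT w \/ has_vp_form w.
Proof.
have [r [i [D [_ w_equiv]]]] := eval_power_form w.
have [r0|r_gt0] := posnP r.
  left; have [u inj_u wE] := sub_equiv_sym w_equiv.
  apply: (@coordinate_Pw_constant _ _ _ (fun j => wcomp u (shift_sub i D j)) i).
    by move=> x y; rewrite -!wsub_comp => /(wsub_shift_inj class2)/inj_u.
  by move=> x; rewrite -wE -wsub_comp wsub_shift // eqxx r0 expg1.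
right; have [ch [bl [f_equiv]]] := power_form_normal r i D.
have {}f_equiv := sub_equiv_trans w_equiv f_equiv.
(* The last chain edge is moved to open the second product of [vp]. With an empty chain,
   [attach_block] creates an edge from [x_i] to the first block; its exponent may equal that of the
   block, since strict growth stops before index [l]. *)
case: (lastP ch) f_equiv => [|ch' [v e]].
  case: bl => [|[[a b] e] bl] f_equiv uq _ _ blr.
    exists r, 1%N, 1%N, (fun _ => 0); do 7!split=> //.
    exact/sub_equiv_automorphic/(sub_equiv_trans f_equiv)/edge_form_nil.
  have uq' : uniq [:: i, a, b & block_verts bl] by move: uq; rewrite cats0.
  apply: (@chain_vp_form w r i [:: (a, e)] b e bl) => //=; last by case/andP: blr => /= ->.
  exact: sub_equiv_trans f_equiv (attach_block _ _ uq').
rewrite chain_edges_rcons cat_rcons !map_rcons => f_equiv uq srt.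
rewrite all_rcons => /andP[/= e_lt chr] blr; apply: chain_vp_form r_gt0 f_equiv _ _ chr _.
- move: uq; rewrite /= !mem_cat uniq_catC -cats1 -catA /= !(mem_cat, inE).
  by rewrite orbC -!orbA.
- by move: srt; rewrite -cats1; apply: subseq_sorted (prefix_subseq _ _); apply: ltn_trans.
- by rewrite /= e_lt.
Qed.

Lemma commutator_normal_form w : in_commutator_sub w ->
  exists (n : nat) (s : nat -> nat),
    1 <= n /\ n <= k.+1 /\ Fk_automorphic gT w (vp k p 0 1 n s).
Proof.
move=> [cs w_cs]; pose w' : word k.+1 := flatten [seq wcomm c.1 c.2 | c <- cs].
have [|D DE] := @eval_expo_eq _ _ class2 w' [::].
  rewrite expo_flatten big1 => [|c _]; last exact: expo_wcomm.
  by rewrite /expo big_nil.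
have wE x : eval_word w x = cval (cform D x).
  by rewrite -eval_freduce w_cs eval_freduce -/w' DE mul1g.
(* All vertices are free and [fl = false] forbids a chain. Taking [r = N] kills the remainder, as
   [p^N = 0]. *)
have [|//|//|i1 j1|u [ch [bl [E [inj_u fix_u uE uq [inS srt rng blr ch0]]]]]] :=
  @normal_form gT k.+1 p class2 expring_unit_or_dvd N (#|[set: 'I_k.+1]| + (N - 0))
    [set: 'I_k.+1] ord0 false 0 D.
- by [].
- by rewrite !inE.
move: uE uq; rewrite {}ch0 // => {ch srt rng inS} uE uq.
have f_equiv : sub_equiv (eval_word w) (fun x => cval (edge_sum p bl x)).
  exists u => // x; rewrite wE; have := uE x.
  by rewrite scale1r expring_expN scale0r addr0 => ->.
case: bl uE uq blr f_equiv => [|[[a b] e] bl] uE uq blr f_equiv.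
  exists 1%N, (fun _ => 0); do 2!split=> //; apply: sub_equiv_automorphic.
  apply: sub_equiv_trans f_equiv _; exists (@wid k.+1) => [x y|x].
    by rewrite !wsub_id.
  by rewrite eval_vp // expg0 mul1g /edge_sum !big_nil.
(* The first block is read as attached to an empty chain at [a], which gives [l = 1]. *)
have {}uq : uniq (a :: map fst ([::] : seq ('I_k.+1 * nat)) ++ b :: block_verts bl).
  by move: uq; rewrite cats0.
have [le_n [v inj_v vE]] := @normal_form_vp gT k p class2 a [::] b e bl uq.
exists (0 + (size bl).+1.*2), (fun i => nth 0 (block_exps ((a, b, e) :: bl)) i.-1).
split; first by rewrite add0n doubleS.
split; first exact: le_n.
apply: sub_equiv_automorphic; apply: sub_equiv_trans f_equiv _.
by exists v => // x; rewrite -[LHS]mul1g; apply: (vE 0).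
Qed.

End PGroup.

Close Scope group_scope.

Theorem theorem3p4 (p : nat) (gT : finGroupType) (k : nat) (w : word k.+1) :
  prime p -> (p.-group [set: gT])%g -> nil_class [set: gT] = 2 ->
  (~ in_commutator_sub w ->
     Pw_constant gT w \/
     exists (r l n : nat) (s : nat -> nat),
       0 < r /\ 1 <= l /\ l <= n /\ n <= k.+1 /\
       (forall i, 1 <= i -> i.+1 <= l.-1 -> s i < s i.+1) /\
       (1 < l -> s l.-1 < r) /\
       (forall j, l <= j -> j <= n.-1 -> s j < r) /\
       Fk_automorphic gT w (vp k p (p ^ r) l n s)) /\
  (in_commutator_sub w ->
     exists (n : nat) (s : nat -> nat),
       1 <= n /\ n <= k.+1 /\ Fk_automorphic gT w (vp k p 0 1 n s)).
Proof.
move=> p_pr pG cl2; have class2 : nil_class [set: gT] <= 2 by rewrite cl2.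
have [N cardG] := p_natP pG.
(* The trivial group has class 0. *)
have N_gt0 : 0 < N.
  case: N cardG => // /card1_trivg G1.
  by have := nil_class0 [set: gT]; rewrite cl2 G1 eqxx.
split=> [_|w_comm].
  exact: (noncommutator_normal_form class2 p_pr N_gt0 cardG w).
exact: (commutator_normal_form class2 p_pr N_gt0 cardG w_comm).
Qed.
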